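(* Let $f(x), g(x) \in \mathbb{C}[[x]]$ be formal power series, and let $g(x)$ have zero constant term. Then, in $\mathbb{C}[[x]][[w]]$, $$e^{w\frac{d}{dx}}f(g(x))=\sum_{n \geq 0}\frac{f^{(n)}(g(x))}{n!}\left(\sum_{m \geq 1}\frac{g^{(m)}(x)}{m!}w^{m}\right)^{n}.$$
   Context: Here $x,w$ are commuting formal variables, $\frac{d}{dx}$ is the formal derivative on $\mathbb{C}[[x]]$, $f^{(n)}$ and $g^{(m)}$ denote the $n$-th and $m$-th formal derivatives of $f$ and $g$, and $e^{w\frac{d}{dx}}=\sum_{n\ge 0}\frac{w^n}{n!}\left(\frac{d}{dx}\right)^n:\mathbb{C}[[x]]\to\mathbb{C}[[x]][[w]]$. *)

(* Defs.v *)
From HB Require Import structures.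
From mathcomp Require Import all_boot all_order all_algebra.
From mathcomp Require Import boolp classical_sets cardinality fsbigop reals.
From mathcomp Require Export complex.

Set Implicit Arguments.
Unset Strict Implicit.
Unset Printing Implicit Defensive.

Import GRing.Theory.

Local Open Scope ring_scope.

(* The formal power series ring {fps A} = A[[t]] in one variable t, for any
   commutative ring A. Hence C[[x]] is {fps C} and C[[x]][[w]] is
   {fps {fps C}}: its outer variable is w, and its coefficients are series
   in x. *)
Record fps (A : Type) := FPS { fpscoef : nat -> A }.

Notation "{ 'fps' A }" := (fps A) (at level 0, format "{ 'fps'  A }").

Lemma fpsP (A : Type) (f g : {fps A}) :
  (forall k, fpscoef f k = fpscoef g k) <-> f = g.
Proof.
split=> [|-> //]; case: f g => [f] [g] /= fg.
by congr FPS; apply/funext.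
Qed.

HB.instance Definition _ (A : Type) := gen_eqMixin {fps A}.
HB.instance Definition _ (A : Type) := gen_choiceMixin {fps A}.

Section Zmodule.
Variable A : zmodType.
Implicit Types f g h : {fps A}.

Definition fps_zero : {fps A} := FPS (fun=> 0).
Definition fps_opp f : {fps A} := FPS (fun k => - fpscoef f k).
Definition fps_add f g : {fps A} := FPS (fun k => fpscoef f k + fpscoef g k).

Fact fps_addA : associative fps_add.
Proof. by move=> f g h; apply/fpsP => k /=; rewrite addrA. Qed.
Fact fps_addC : commutative fps_add.
Proof. by move=> f g; apply/fpsP => k /=; rewrite addrC. Qed.
Fact fps_add0 : left_id fps_zero fps_add.
Proof. by move=> f; apply/fpsP => k /=; rewrite add0r. Qed.
Fact fps_addN : left_inverse fps_zero fps_opp fps_add.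
Proof. by move=> f; apply/fpsP => k /=; rewrite addNr. Qed.

HB.instance Definition _ := GRing.isZmodule.Build {fps A}
  fps_addA fps_addC fps_add0 fps_addN.

Lemma fpscoef0 k : fpscoef (0 : {fps A}) k = 0. Proof. by []. Qed.
Lemma fpscoefN f k : fpscoef (- f) k = - fpscoef f k. Proof. by []. Qed.
Lemma fpscoefD f g k : fpscoef (f + g) k = fpscoef f k + fpscoef g k.
Proof. by []. Qed.

Definition fps_deriv f : {fps A} := FPS (fun k => fpscoef f k.+1 *+ k.+1).

Definition fps_derivn n f : {fps A} := iter n fps_deriv f.

(* The infinite sum over n >= a of the F n, for a family F that is summable,
   i.e. in which only finitely many F n contribute to each coefficient.
   Each coefficient is a finitely supported sum (with junk value 0 if the
   support is infinite). *)
Definition fps_summable (F : nat -> {fps A}) : Prop :=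
  forall k, finite_set [set n | fpscoef (F n) k != 0].

Definition fps_sum (a : nat) (F : nat -> {fps A}) : {fps A} :=
  FPS (fun k => \sum_(n \in [set n | (a <= n)%N]) fpscoef (F n) k).

End Zmodule.

Notation "\fpssum_ ( n >= a ) F" := (fps_sum a (fun n : nat => F%R))
  (at level 41, F at level 41, n at level 50,
   format "'[' \fpssum_ ( n  >=  a ) '/  '  F ']'") : ring_scope.

Notation "f ^`fps( n )" := (fps_derivn n f)
  (at level 1, left associativity, format "f ^`fps( n )") : ring_scope.

Section Ring.
Variable A : comNzRingType.
Implicit Types f g h : {fps A}.

Definition fps_one : {fps A} := FPS (fun k => (k == 0)%:R).
Definition fps_mul f g : {fps A} :=
  FPS (fun k => \sum_(i < k.+1) fpscoef f i * fpscoef g (k - i)%N).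

Definition fps_trunc n f : {poly A} := \poly_(i < n) fpscoef f i.

Lemma fps_mul_trunc n f g k : (k < n)%N ->
  fpscoef (fps_mul f g) k = (fps_trunc n f * fps_trunc n g)`_k.
Proof.
move=> kn; rewrite coefM; apply: eq_bigr => i _ /=.
rewrite !coef_poly (leq_ltn_trans _ kn) ?(leq_ltn_trans _ kn) ?leq_subr //.
by rewrite -ltnS.
Qed.

Fact fps_mulA : associative fps_mul.
Proof.
move=> f g h; apply/fpsP => k.
pose t := fps_trunc k.+1.
transitivity ((t f * (t g * t h))`_k).
  rewrite coefM; apply: eq_bigr => i _.
  by rewrite coef_poly ltn_ord (@fps_mul_trunc k.+1) // ltnS leq_subr.
rewrite mulrA coefM; apply: eq_bigr => i _.
by rewrite [(t h)`_ _]coef_poly ltnS leq_subr (@fps_mul_trunc k.+1).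
Qed.

Fact fps_mulC : commutative fps_mul.
Proof.
move=> f g; apply/fpsP => k.
by rewrite !(@fps_mul_trunc k.+1) // mulrC.
Qed.

Fact fps_mul1 : left_id fps_one fps_mul.
Proof.
move=> f; apply/fpsP => k /=.
rewrite big_ord_recl /= mul1r subn0 big1 ?addr0 // => i _.
by rewrite mul0r.
Qed.

Fact fps_mulDl : left_distributive fps_mul +%R.
Proof.
move=> f g h; apply/fpsP => k /=.
by rewrite -big_split; apply: eq_bigr => i _; rewrite mulrDl.
Qed.

Fact fps_one_neq0 : fps_one != 0.
Proof. by apply/eqP => /fpsP/(_ 0) /= /eqP; rewrite oner_eq0. Qed.

HB.instance Definition _ := GRing.Zmodule_isComNzRing.Build {fps A}
  fps_mulA fps_mulC fps_mul1 fps_mulDl fps_one_neq0.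

Lemma fpscoef1 k : fpscoef (1 : {fps A}) k = (k == 0)%:R. Proof. by []. Qed.
Lemma fpscoefM f g k :
  fpscoef (f * g) k = \sum_(i < k.+1) fpscoef f i * fpscoef g (k - i)%N.
Proof. by []. Qed.

Definition fps_scale a f : {fps A} := FPS (fun k => a * fpscoef f k).

Fact fps_scaleA a b f : fps_scale a (fps_scale b f) = fps_scale (a * b) f.
Proof. by apply/fpsP => k /=; rewrite mulrA. Qed.
Fact fps_scale1 : left_id 1 fps_scale.
Proof. by move=> f; apply/fpsP => k /=; rewrite mul1r. Qed.
Fact fps_scaleDr : right_distributive fps_scale +%R.
Proof. by move=> a f g; apply/fpsP => k /=; rewrite mulrDr. Qed.
Fact fps_scaleDl f : {morph fps_scale^~ f : a b / a + b}.
Proof. by move=> a b; apply/fpsP => k /=; rewrite mulrDl. Qed.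

HB.instance Definition _ := GRing.Zmodule_isLmodule.Build A {fps A}
  fps_scaleA fps_scale1 fps_scaleDr fps_scaleDl.

Fact fps_scaleAl (a : A) f g : a *: (f * g) = (a *: f) * g.
Proof.
apply/fpsP => k /=; rewrite mulr_sumr.
by apply: eq_bigr => i _; rewrite mulrA.
Qed.

HB.instance Definition _ := GRing.Lmodule_isLalgebra.Build A {fps A}
  fps_scaleAl.
HB.instance Definition _ := GRing.Lalgebra_isComAlgebra.Build A {fps A}.

Lemma fpscoefZ a f k : fpscoef (a *: f) k = a * fpscoef f k.
Proof. by []. Qed.

Definition fps_var : {fps A} := FPS (fun k => (k == 1)%:R).

(* f(g), meaningful when g has zero constant term (fps_comp_summable). *)
Definition fps_comp f g : {fps A} :=
  \fpssum_(n >= 0) (fpscoef f n *: g ^+ n).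

Lemma fpscoef_exp_small g n k :
  fpscoef g 0 = 0 -> (k < n)%N -> fpscoef (g ^+ n) k = 0.
Proof.
move=> g0; elim: n k => [//|n IHn] k; rewrite ltnS => kn.
rewrite exprS fpscoefM big1 // => -[[|i] ik] _ /=; first by rewrite g0 mul0r.
rewrite IHn ?mulr0 //; apply: leq_trans kn.
by rewrite ltn_subrL /= (leq_ltn_trans (leq0n i)) // -ltnS.
Qed.

Lemma fps_exp_summable (c : nat -> A) g :
  fpscoef g 0 = 0 -> fps_summable (fun n => c n *: g ^+ n).
Proof.
move=> g0 k; apply: (@sub_finite_set _ _ `I_k.+1); last exact: finite_II.
move=> n; apply: contraPT; rewrite -leqNgt => kn.
by apply/negP; rewrite negbK fpscoefZ fpscoef_exp_small ?mulr0.
Qed.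

Lemma fps_comp_summable f g :
  fpscoef g 0 = 0 -> fps_summable (fun n => fpscoef f n *: g ^+ n).
Proof. exact: fps_exp_summable. Qed.

Lemma fpscoef_var_exp n k : fpscoef (fps_var ^+ n) k = (k == n)%:R.
Proof.
elim: n k => [|n IHn] k; first by rewrite expr0 fpscoef1.
rewrite exprS fpscoefM; case: k => [|k].
  by rewrite big_ord_recl big_ord0 /= mul0r addr0.
rewrite !big_ord_recl big1 => [|i _] /=; last by rewrite mul0r.
by rewrite mul0r add0r mul1r addr0 subSS subn0 IHn eqSS.
Qed.

Lemma fps_var_summable (c : nat -> A) :
  fps_summable (fun n => c n *: fps_var ^+ n).
Proof. by apply: fps_exp_summable. Qed.

Lemma fpscoef_sum_var a (c : nat -> A) k :
  fpscoef (\fpssum_(n >= a) (c n *: fps_var ^+ n)) k =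
  if (a <= k)%N then c k else 0.
Proof.
rewrite /fps_sum [LHS]/fpscoef -/fpscoef.
under eq_fsbigr do rewrite fpscoefZ fpscoef_var_exp.
case: ifPn => ak; last first.
  rewrite fsbig1 // => n /= an; case: eqVneq => [kn|]; last by rewrite mulr0.
  by rewrite kn an in ak.
rewrite -(@fsbig_widen _ _ _ _ [set k]) => [|n /= -> //|n /= [_ /eqP nk]].
  by rewrite fsbig_set1 eqxx mulr1.
by rewrite eq_sym (negPf nk) mulr0.
Qed.

End Ring.

Arguments fps_var {A}.
Notation "f \oF g" := (fps_comp f g) (at level 50) : ring_scope.

Section ExpDeriv.
Variable A : comUnitRingType.
Implicit Types f g : {fps A}.

Local Notation w := (fps_var : {fps {fps A}}).

(* The operator e^{w d/dx} : A[[x]] -> A[[x]][[w]]. *)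
Definition exp_wD f : {fps {fps A}} :=
  \fpssum_(n >= 0) ((n`!%:R^-1 *: f^`fps(n)) *: w ^+ n).

Lemma exp_wD_rhs_summable (c : nat -> {fps A}) g :
  fps_summable
    (fun n => c n *: (\fpssum_(m >= 1) ((m`!%:R^-1 *: g^`fps(m)) *: w ^+ m)) ^+ n).
Proof. by apply: fps_exp_summable; rewrite fpscoef_sum_var. Qed.

End ExpDeriv.

(* Main.v *)
(** The map [E = e^{w d/dx}] is a ring morphism: [F = E f] is the only solution of
    [dF/dw = dF/dx] whose [w]-constant term is [f], and the solutions of this
    equation are closed under products.  Writing [E g = g + h], where [h] is the
    inner sum over [m >= 1], this gives [E (g^n) = (g + h)^n], and the binomial
    theorem is the claim for [f = x^n].  Finally, the coefficients of [x^j w^k] on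
    both sides depend linearly on the coefficients of [f] of index [<= j + k] only,
    which reduces a general [f] to the powers of [x]. *)
Require Import Defs.
From mathcomp Require Import all_boot all_order all_algebra.
From mathcomp Require Import classical_sets fsbigop.
From mathcomp Require Import reals.

Import GRing.Theory.
Local Open Scope ring_scope.
Local Open Scope complex_scope.

Set Implicit Arguments.
Unset Strict Implicit.
Unset Printing Implicit Defensive.

Lemma fpscoef_sum (A : zmodType) (I : Type) (r : seq I) (P : pred I)
    (F : I -> {fps A}) k :
  fpscoef (\sum_(i <- r | P i) F i) k = \sum_(i <- r | P i) fpscoef (F i) k.
Proof. by elim/big_rec2: _ => // i a b _ <-. Qed.

Lemma fpscoefMn (A : zmodType) (f : {fps A}) n k :
  fpscoef (f *+ n) k = fpscoef f k *+ n.
Proof. by elim: n => [//|n IHn]; rewrite !mulrS fpscoefD IHn. Qed.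

Lemma fpscoef_derivn (A : zmodType) (f : {fps A}) n k :
  fpscoef (f^`fps(n)) k = fpscoef f (k + n) *+ (k + n) ^_ n.
Proof.
elim: n k => [|n IHn] k; first by rewrite addn0.
rewrite [LHS]/= -/(fps_derivn n f) IHn addSnnS -mulrnA; congr (_ *+ _).
by rewrite ffactnSr -addSnnS addnK.
Qed.

Lemma fpscoefM0 (A : comNzRingType) (f g : {fps A}) :
  fpscoef (f * g) 0 = fpscoef f 0 * fpscoef g 0.
Proof. by rewrite fpscoefM big_ord1. Qed.

Lemma fps_derivD (A : zmodType) (f g : {fps A}) :
  fps_deriv (f + g) = fps_deriv f + fps_deriv g.
Proof. by apply/fpsP => k /=; rewrite mulrnDl. Qed.

Lemma fps_deriv_sum (A : zmodType) (I : Type) (r : seq I) (P : pred I)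
    (F : I -> {fps A}) :
  fps_deriv (\sum_(i <- r | P i) F i) = \sum_(i <- r | P i) fps_deriv (F i).
Proof.
elim/big_rec2: _ => [|i a b _ <-]; last by rewrite fps_derivD.
by apply/fpsP => k /=; rewrite mul0rn.
Qed.

(** Reduces to the product rule for polynomials: up to index [k], the derivatives only see
    coefficients of index at most [k + 1], which truncation at [k + 2] keeps. *)
Lemma fps_derivM (A : comNzRingType) (f g : {fps A}) :
  fps_deriv (f * g) = fps_deriv f * g + f * fps_deriv g.
Proof.
apply/fpsP => k; rewrite fpscoefD [LHS]/=.
have truncD (u : {fps A}) i : (i <= k)%N ->
    ((fps_trunc k.+2 u)^`())`_i = fpscoef (fps_deriv u) i.
  by move=> ik; rewrite coef_deriv coef_poly !ltnS ik.
have trunc0 (u : {fps A}) i : (i <= k)%N ->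
    (fps_trunc k.+2 u)`_i = fpscoef u i.
  by move=> ik; rewrite coef_poly ltnS (leq_trans ik).
rewrite -[X in X *+ _]/(fpscoef (fps_mul f g) k.+1) (@fps_mul_trunc _ k.+2) //.
rewrite -coef_deriv derivM coefD !coefM !fpscoefM.
by congr (_ + _); apply: eq_bigr => i _;
  rewrite truncD ?trunc0 ?leq_subr // -ltnS.
Qed.

(** The derivation d/dx of A[[x]][[w]], acting on each coefficient in [w]; at this type [fps_deriv]
    itself is d/dw. *)
Definition fps_derivx (A : zmodType) (F : {fps {fps A}}) : {fps {fps A}} :=
  FPS (fun k => fps_deriv (fpscoef F k)).

Lemma fps_derivxM (A : comNzRingType) (F G : {fps {fps A}}) :
  fps_derivx (F * G) = fps_derivx F * G + F * fps_derivx G.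
Proof.
apply/fpsP => k; rewrite [LHS]/= fps_deriv_sum fpscoefD !fpscoefM -big_split.
by apply: eq_bigr => i _; rewrite fps_derivM.
Qed.

(** Since [g ^+ n] has order at least [n], the terms with [n > k] do not contribute. The bound [N]
    is left free so that several such sums can share one range. *)
Lemma fpscoef_sum_exp (A : comNzRingType) (c : nat -> A) (g : {fps A}) N k :
  fpscoef g 0 = 0 -> (k < N)%N ->
  fpscoef (\fpssum_(n >= 0) (c n *: g ^+ n)) k =
  \sum_(n < N) c n * fpscoef (g ^+ n) k.
Proof.
move=> g0 kN; rewrite /fps_sum [LHS]/fpscoef -/fpscoef.
rewrite -(@fsbig_widen _ _ _ _ `I_N) => [|//|n /= [_ /negP]]; last first.
  rewrite -leqNgt => Nn; rewrite -[LHS]/(c n * fpscoef (g ^+ n) k).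
  rewrite fpscoef_exp_small ?mulr0 //.
  exact: leq_trans Nn.
exact/esym/(fsbig_ord _ _ (fun n => c n * fpscoef (g ^+ n) k)).
Qed.

Lemma fpscoef_comp (A : comNzRingType) (f g : {fps A}) N k :
  fpscoef g 0 = 0 -> (k < N)%N ->
  fpscoef (f \oF g) k = \sum_(n < N) fpscoef f n * fpscoef (g ^+ n) k.
Proof. exact: fpscoef_sum_exp. Qed.

Lemma fpscoef_divided_derivn (A : numFieldType) (f : {fps A}) n k :
  n`!%:R^-1 * fpscoef (f^`fps(n)) k = fpscoef f (k + n) *+ 'C(k + n, n).
Proof.
rewrite fpscoef_derivn -bin_ffact mulrnA -[X in _ * X]mulr_natl mulKf //.
by rewrite Num.Theory.pnatr_eq0 -lt0n fact_gt0.
Qed.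

(* For [n < m] the truncated exponent [n - m] is junk, but ['C(n, m) = 0]. *)
Lemma fpscoef_derivn_comp (A : numFieldType) (f g : {fps A}) m N k :
  fpscoef g 0 = 0 -> (k + m < N)%N ->
  fpscoef (m`!%:R^-1 *: (f^`fps(m) \oF g)) k =
  \sum_(n < N) fpscoef f n * (fpscoef (g ^+ (n - m)) k *+ 'C(n, m)).
Proof.
move=> g0 kmN.
have mN : (m <= N)%N by apply: leq_trans (ltnW kmN); rewrite leq_addl.
rewrite fpscoefZ (@fpscoef_comp _ _ _ (N - m)) ?ltn_subRL 1?addnC //.
rewrite -(big_mkord xpredT (fun p => fpscoef (f^`fps(m)) p * fpscoef (g ^+ p) k)).
rewrite -(big_mkord xpredT
  (fun n => fpscoef f n * (fpscoef (g ^+ (n - m)) k *+ 'C(n, m)))).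
rewrite (big_cat_nat (leq0n m) mN) /= [X in X + _]big_nat.
rewrite [X in X + _]big1 => [|n /= nm]; last first.
  by rewrite bin_small // mulr0.
rewrite add0r -[X in \big[_/_]_(X <= _ < N) _]add0n big_addn mulr_sumr.
apply: eq_bigr => p _.
by rewrite addnK mulrA fpscoef_divided_derivn mulrnAl mulrnAr.
Qed.

(** At [w^k] the equation reads (k+1) F_(k+1) = dF_k/dx, a recursion that fixes every coefficient
    from F_0, because [k.+1] can be cancelled in characteristic zero. *)
Lemma fps_transport_uniq (A : numFieldType) (F G : {fps {fps A}}) :
  fps_deriv F = fps_derivx F -> fps_deriv G = fps_derivx G ->
  fpscoef F 0 = fpscoef G 0 -> F = G.
Proof.
move=> dF dG FG0; apply/fpsP; elim=> [//|k IHk].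
have: fpscoef F k.+1 *+ k.+1 = fpscoef G k.+1 *+ k.+1.
  move/fpsP/(_ k): dF => /= ->; move/fpsP/(_ k): dG => /= ->.
  by rewrite IHk.
move=> /fpsP eqn; apply/fpsP => j; move: (eqn j); rewrite !fpscoefMn.
exact: Num.Theory.pmulrnI.
Qed.

Section ExpWD.
Variable A : numFieldType.
Implicit Types f g : {fps A}.

Lemma fpscoef_exp_wD f k : fpscoef (exp_wD f) k = k`!%:R^-1 *: f^`fps(k).
Proof. by rewrite fpscoef_sum_var. Qed.

Lemma fpscoef_exp_wD0 f : fpscoef (exp_wD f) 0 = f.
Proof. by rewrite fpscoef_exp_wD fact0 invr1 scale1r. Qed.

Lemma fpscoef2_exp_wD f j k :
  fpscoef (fpscoef (exp_wD f) k) j = fpscoef f (j + k) *+ 'C(j + k, k).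
Proof. by rewrite fpscoef_exp_wD fpscoefZ fpscoef_divided_derivn. Qed.

Lemma exp_wD_transport f : fps_deriv (exp_wD f) = fps_derivx (exp_wD f).
Proof.
apply/fpsP => k; apply/fpsP => j.
transitivity (fpscoef (fpscoef (exp_wD f) k.+1) j *+ k.+1).
  by rewrite -fpscoefMn.
transitivity (fpscoef (fpscoef (exp_wD f) k) j.+1 *+ j.+1); last by [].
rewrite !fpscoef2_exp_wD addSnnS -!mulrnA.
(* The identity needed is (k+1) C(j+k+1, k+1) = (j+1) C(j+k+1, k). *)
congr (_ *+ _); have := mul_bin_left (j + k.+1) k.
by rewrite -addSnnS addnK ![(_ * _.+1)%N]mulnC.
Qed.

Lemma exp_wDM f g : exp_wD (f * g) = exp_wD f * exp_wD g.
Proof.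
apply: fps_transport_uniq; first exact: exp_wD_transport.
  by rewrite fps_derivM fps_derivxM !exp_wD_transport.
by rewrite [RHS]fpscoefM0 3!fpscoef_exp_wD0.
Qed.

Lemma exp_wD1 : exp_wD (1 : {fps A}) = 1.
Proof.
apply: fps_transport_uniq; first exact: exp_wD_transport; last first.
  exact: fpscoef_exp_wD0.
by apply/fpsP => k; apply/fpsP => j /=; case: k; case: j => *; rewrite ?mul0rn.
Qed.

Lemma exp_wDX f n : exp_wD (f ^+ n) = exp_wD f ^+ n.
Proof.
by elim: n => [|n IHn]; [rewrite !expr0 exp_wD1 | rewrite !exprS exp_wDM IHn].
Qed.

Definition exp_wD_tail g : {fps {fps A}} :=
  \fpssum_(m >= 1) ((m`!%:R^-1 *: g^`fps(m)) *: fps_var ^+ m).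

(** Here [g%:A] is [g] regarded as a series constant in [w]. *)
Lemma exp_wD_tailE g : exp_wD g = g%:A + exp_wD_tail g.
Proof.
apply/fpsP => k; rewrite fpscoef_exp_wD fpscoefD fpscoefZ fpscoef1 fpscoef_sum_var.
case: k => [|k]; first by rewrite mulr1 addr0 fact0 invr1 scale1r.
by rewrite mulr0 add0r.
Qed.

Lemma exp_wD_tail0 g : fpscoef (exp_wD_tail g) 0 = 0.
Proof. by rewrite fpscoef_sum_var. Qed.

(** The binomial theorem for (g + h)^n, with a range of [m] independent of [n], so that the sums
    over [n] and [m] can later be exchanged. *)
Lemma fpscoef_exp_wD_exp g n N k : (k < N)%N ->
  fpscoef (exp_wD (g ^+ n)) k =
  \sum_(m < N) (g ^+ (n - m) * fpscoef (exp_wD_tail g ^+ m) k) *+ 'C(n, m).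
Proof.
move=> kN; rewrite exp_wDX exp_wD_tailE exprDn fpscoef_sum.
pose F m := (g ^+ (n - m) * fpscoef (exp_wD_tail g ^+ m) k) *+ 'C(n, m).
have F0 m : (n < m)%N || (k < m)%N -> F m = 0.
  case/orP=> lt_m; first by rewrite /F bin_small.
  by rewrite /F fpscoef_exp_small ?exp_wD_tail0 // mulr0 mul0rn.
(* Nonzero terms have [m <= minn n k], so the ranges [n.+1] and [N] give the same sum. *)
have sumF M : (minn n k < M)%N ->
    \sum_(m < M) F m = \sum_(m < (minn n k).+1) F m.
  move=> leM; rewrite -!(big_mkord xpredT F) (big_cat_nat (leq0n _) leM) //=.
  rewrite [X in _ + X]big_nat [X in _ + X]big1 ?addr0 // => m /andP[].
  by rewrite gtn_min => /F0.
transitivity (\sum_(m < n.+1) F m); last first.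
  by rewrite !sumF // ?ltnS ?geq_minl // gtn_min kN orbT.
apply: eq_bigr => m _; rewrite fpscoefMn; congr (_ *+ _).
by rewrite exprZn expr1n -scalerAl mul1r.
Qed.

Lemma exp_wD_comp f g : fpscoef g 0 = 0 ->
  exp_wD (f \oF g) =
  \fpssum_(n >= 0) ((n`!%:R^-1 *: (f^`fps(n) \oF g)) *: exp_wD_tail g ^+ n).
Proof.
(* Only coefficients of [f] of index at most [j + k] matter; this one [N] bounds both [n] and [m] in
   every expansion below. *)
move=> g0; apply/fpsP => k; apply/fpsP => j; pose N := (j + k).+1.
have kN : (k < N)%N by rewrite ltnS leq_addl.
have tail0 := exp_wD_tail0 g.
transitivity (\sum_(n < N) \sum_(m < N)
    fpscoef f n *
    fpscoef ((g ^+ (n - m) * fpscoef (exp_wD_tail g ^+ m) k) *+ 'C(n, m)) j).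
  rewrite fpscoef2_exp_wD (fpscoef_comp f g0 (ltnSn _)) -sumrMnl.
  apply: eq_bigr => n _.
  rewrite -mulrnAr -fpscoef2_exp_wD (fpscoef_exp_wD_exp g n kN).
  by rewrite fpscoef_sum mulr_sumr.
rewrite (fpscoef_sum_exp _ tail0 kN) fpscoef_sum.
rewrite exchange_big; apply: eq_bigr => m _.
(* For [m > k] both sides vanish, as h^m has order at least [m] in [w]. Otherwise
   [i + m <= j + k < N] for all [i <= j], as [fpscoef_derivn_comp] requires. *)
have [km|mk] := ltnP k m.
  rewrite fpscoef_exp_small // mulr0 big1 // => n _.
  by rewrite mulr0 mul0rn mulr0.
(* Expanding the product in [x] and summing over [n] first leaves, for each [i], the [x^i]
   coefficient of f^(m)(g)/m!. *)
transitivity (\sum_(i < j.+1) \sum_(n < N)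
    fpscoef f n * (fpscoef (g ^+ (n - m)) i *+ 'C(n, m)) *
    fpscoef (fpscoef (exp_wD_tail g ^+ m) k) (j - i)).
  rewrite exchange_big; apply: eq_bigr => n _.
  rewrite fpscoefMn fpscoefM -sumrMnl mulr_sumr; apply: eq_bigr => i _.
  by rewrite -mulrnAl mulrA.
rewrite fpscoefM; apply: eq_bigr => i _.
by rewrite (@fpscoef_derivn_comp _ _ _ _ N) ?mulr_suml // ltnS leq_add // -ltnS.
Qed.

End ExpWD.

Theorem proposition2p1 (R : realType) (f g : {fps R[i]}) (g0 : fpscoef g 0 = 0) :
  exp_wD (f \oF g) =
  \fpssum_(n >= 0)
    ((n`!%:R^-1 *: (f^`fps(n) \oF g)) *:
     (\fpssum_(m >= 1) ((m`!%:R^-1 *: g^`fps(m)) *: fps_var ^+ m)) ^+ n).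
Proof. exact: exp_wD_comp. Qed.
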